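(* Let $\Phi=\{\varphi_n\}_{n=1}^N$ be a real-valued frame over $\mathbb{C}^3$. Then $\Phi$ is conjugate phase retrievable over $\mathbb{C}^3$ if and only if $\ker(\Omega_\Phi)=\{0\}$.
   Context: A frame over $\mathbb{C}^M$ is a finite family $\{\varphi_n\}_{n=1}^N$ spanning $\mathbb{C}^M$; it is real-valued if all vectors have real entries. $\Phi$ is conjugate phase retrievable over $\mathbb{C}^M$ if for all $x,y\in\mathbb{C}^M$, $|\langle x,\varphi_n\rangle|=|\langle y,\varphi_n\rangle|$ for all $n$ implies that there is $\theta\in\mathbb{R}$ with $x=e^{i\theta}y$ or $x=e^{i\theta}\overline{y}$, where $\overline{y}$ is the coordinatewise conjugate. For $\varphi=(\varphi_1,\ldots,\varphi_M)^T\in\mathbb{R}^M$, let $$\omega_\varphi=(\varphi_1^2\ \cdots\ \varphi_M^2\ \ 2\varphi_1\varphi_2\ \cdots\ 2\varphi_1\varphi_M\ \cdots\ 2\varphi_{M-1}\varphi_M)^T\in\mathbb{R}^{M(M+1)/2}$$ (squares first, then $2\varphi_i\varphi_j$ for $i<j$ in row order). $\Omega_\Phi$ is the real $N\times\frac{M(M+1)}{2}$ matrix whose $n$-th row is $\omega_{\varphi_n}^T$, and $\ker(\Omega_\Phi)=\{\mathbf{v}\in\mathbb{R}^{M(M+1)/2}:\Omega_\Phi\mathbf{v}=0\}$. Here $M=3$. *)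

(* Defs.v *)
From HB Require Import structures.
From mathcomp Require Import all_boot all_order all_algebra.
From mathcomp Require Import complex.
From mathcomp Require Import all_classical all_reals all_analysis.

Set Implicit Arguments.
Unset Strict Implicit.
Unset Printing Implicit Defensive.

Import Order.TTheory GRing.Theory Num.Theory.

Local Open Scope classical_set_scope.
Local Open Scope ring_scope.
Local Open Scope complex_scope.

Section ConjugatePhaseRetrieval.
Variables (R : realType) (M N : nat).

Definition is_frame (Phi : 'I_N -> 'cV[R[i]]_M) : Prop :=
  <<[seq Phi n | n <- enum 'I_N]>>%VS = fullv.

Definition real_valued (Phi : 'I_N -> 'cV[R[i]]_M) : Prop :=
  forall (n : 'I_N) (j : 'I_M), complex.Im (Phi n j 0) = 0.

Definition inner (x y : 'cV[R[i]]_M) : R[i] :=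
  \sum_(j < M) x j 0 * Num.conj (y j 0).

Definition expi (theta : R) : R[i] := cos theta +i* sin theta.

Definition conj_vec (y : 'cV[R[i]]_M) : 'cV[R[i]]_M := map_mx Num.conj y.

Definition conj_phase_retrievable (Phi : 'I_N -> 'cV[R[i]]_M) : Prop :=
  forall x y : 'cV[R[i]]_M,
    (forall n : 'I_N, `|inner x (Phi n)| = `|inner y (Phi n)|) ->
    exists theta : R,
      x = expi theta *: y \/ x = expi theta *: conj_vec y.

Definition omega_seq (phi : 'cV[R]_M) : seq R :=
  [seq phi i 0 ^+ 2 | i <- enum 'I_M] ++
  [seq 2 * phi i 0 * phi j 0 | i <- enum 'I_M,
                               j <- [seq j : 'I_M <- enum 'I_M | (i < j)%N]].

(* [omega_seq phi] has exactly [(M * M.+1)./2] items (see [size_omega_seq]),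
   so the default value of [nth] is never used. *)
Definition omega (phi : 'cV[R]_M) : 'cV[R]_((M * M.+1)./2) :=
  \col_k (omega_seq phi)`_k.

Definition re_family (Phi : 'I_N -> 'cV[R[i]]_M) (n : 'I_N) : 'cV[R]_M :=
  map_mx (@complex.Re R) (Phi n).

(* The n-th row is the transpose of [omega] of the n-th vector. The real parts
   lose nothing, as [Omega] is only meant for real-valued families. *)
Definition Omega (Phi : 'I_N -> 'cV[R[i]]_M) : 'M[R]_(N, (M * M.+1)./2) :=
  \matrix_(n < N) (omega (re_family Phi n))^T.

Definition ker_Omega (Phi : 'I_N -> 'cV[R[i]]_M) : set 'cV[R]_((M * M.+1)./2) :=
  [set v | Omega Phi *m v = 0].

End ConjugatePhaseRetrieval.

Lemma size_omega_seq (R : realType) (M : nat) (phi : 'cV[R]_M) :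
  size (omega_seq phi) = (M * M.+1)./2.
Proof.
rewrite size_cat size_map size_enum_ord size_allpairs_dep sumnE big_map big_enum /=.
have E (i : 'I_M) : size [seq j : 'I_M <- enum 'I_M | (i < j)%N] = (M - i.+1)%N.
  rewrite -(size_map val) (_ : [seq _ | _ <- _] =
    [seq k <- [seq val j | j <- enum 'I_M] | (i < k)%N]); last by rewrite filter_map.
  rewrite val_enum_ord -[in iota _ _](subnKC (ltn_ord i)) iotaD filter_cat.
  rewrite add0n (_ : [seq k <- iota 0 _ | _] = [::]); last first.
    rewrite -(filter_pred0 (iota 0 i.+1)); apply: eq_in_filter => k.
    by rewrite mem_iota ltnS /= ltnNge => ->.
  rewrite (_ : [seq k <- iota i.+1 _ | _] = iota i.+1 (M - i.+1)) ?size_iota //.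
  by apply/all_filterP/allP => k; rewrite mem_iota => /andP[].
rewrite (eq_bigr _ (fun i _ => E i)).
rewrite (reindex_inj rev_ord_inj) /= (eq_bigr (fun i : 'I_M => i : nat)); last first.
  by move=> i _; rewrite subnSK // subKn // ltnW.
rewrite -(big_mkord xpredT id) bin2_sum.
have -> : (M * M.+1 = M.*2 + M * M.-1)%N by case: M {phi E} => // m; rewrite -muln2 -mulnDr add2n.
by rewrite halfD odd_double doubleK add0n bin2.
Qed.

(* Main.v *)
Require Import Defs.
From mathcomp Require Import all_boot all_order all_algebra.
From mathcomp Require Import complex.
From mathcomp Require Import all_classical all_reals all_analysis.
From mathcomp Require Import ring lra.

(** Write x = a + ib and let S_x = a a^T + b b^T, the real part of x x^*. For a
    real vector phi one has |<x, phi>|^2 = phi^T S_x phi, so the measurements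
    only see the matrix S_x through the quadratic forms v |-> v^T S v evaluated
    at the frame vectors. The vectors omega_phi turn these evaluations into a
    linear system: identifying R^6 with the symmetric 3 x 3 matrices, the kernel
    of Omega is the space of symmetric S with phi_n^T S phi_n = 0 for all n.

    If the kernel is trivial, equal measurements give S_x = S_y, since S_x - S_y
    lies in the kernel. Then x and y agree up to a phase and a conjugation
    ([re_gram_inj]): S_x records the real part of every x_i conj(x_j), and once a
    coordinate k with y_k <> 0 is fixed, the imaginary parts of x_j conj(x_k)
    and of y_j conj(y_k) form two real vectors p and q with p p^T = q q^T, so
    that p = q or p = - q. The two signs are the two alternatives.

    If the kernel contains some S <> 0, write S as a combination of three
    squares u_k u_k^T with coefficients d_k ([sum_of_signed_squares]). The frame
    spans, so no nonzero semidefinite form vanishes on it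
    ([frame_isotropic_neg]): the d_k take both signs. Hence at most two of them
    are positive and at most two are negative, and dimension three is what makes
    both parts sums of two squares, that is, matrices S_x and S_y
    ([indefinite_re_gramB]). Now x and y have the same measurements but
    S_x <> S_y, while S_x is invariant under phases and conjugation, so x and y
    are not equivalent. *)

Set Implicit Arguments.
Unset Strict Implicit.
Unset Printing Implicit Defensive.

Import Order.TTheory GRing.Theory Num.Theory.

Local Open Scope classical_set_scope.
Local Open Scope ring_scope.
Local Open Scope complex_scope.

(** * Quadratic forms as combinations of squares *)

Section QuadraticForms.
Variables (R : realFieldType) (n : nat).
Implicit Types (S : 'M[R]_n) (u v : 'cV[R]_n).

Definition qform S v : R := (v^T *m S *m v) 0 0.

Lemma qformD S T v : qform (S + T) v = qform S v + qform T v.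
Proof. by rewrite /qform mulmxDr mulmxDl mxE. Qed.

Lemma qformZ c S v : qform (c *: S) v = c * qform S v.
Proof. by rewrite /qform -scalemxAr -scalemxAl mxE. Qed.

Lemma qform_sum (I : finType) (S : I -> 'M[R]_n) v :
  qform (\sum_k S k) v = \sum_k qform (S k) v.
Proof. by rewrite /qform mulmx_sumr mulmx_suml summxE. Qed.

Lemma qform_square u v : qform (u *m u^T) v = (u^T *m v) 0 0 ^+ 2.
Proof.
rewrite /qform mulmxA -mulmxA [in LHS]mxE big_ord1 expr2; congr (_ * _).
by rewrite -[RHS](mxE trmx_key (fun i j => (u^T *m v) j i)) -/(trmx _) trmx_mul trmxK.
Qed.

(** Polarization: evaluating at e_i, e_j and e_i + e_j isolates 2 S_ij. *)
Lemma qform_eq0 S : S^T = S -> (forall v, qform S v = 0) -> S = 0.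
Proof.
move=> symS S0; apply/matrixP => i j; rewrite mxE.
have qE a b : (delta_mx a 0 : 'cV[R]_n)^T *m S *m (delta_mx b 0 : 'cV[R]_n) = (S a b)%:M.
  rewrite trmx_delta -rowE -colE; apply/matrixP=> k l.
  by rewrite !ord1 !mxE.
have := S0 (delta_mx i 0 + delta_mx j 0).
rewrite /qform [(_ + _)^T]linearD /= !(mulmxDl, mulmxDr) !qE.
have := S0 (delta_mx i 0); have := S0 (delta_mx j 0); rewrite /qform !qE.
have : S j i = S i j by rewrite -{1}symS mxE.
rewrite !mxE eqxx !mulr1n => -> -> ->; lra.
Qed.

(** Lagrange reduction, by induction on the rank. If c = v^T S v is nonzero,
    subtracting c^-1 (S v)(S v)^T keeps the row space inside that of S and sends
    v to 0, which S does not, so the rank drops. *)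
Lemma sum_of_signed_squares r S :
  S^T = S -> (\rank S <= r)%N ->
  exists (d : 'I_r -> R) (u : 'I_r -> 'cV[R]_n),
    S = \sum_k d k *: (u k *m (u k)^T).
Proof.
elim: r S => [|r IH] S symS rkS.
  exists (fun=> 0), (fun=> 0); rewrite big_ord0.
  by apply/eqP; rewrite -mxrank_eq0 -leqn0.
have [->|S_neq0] := eqVneq S 0.
  exists (fun=> 0), (fun=> 0).
  by rewrite big1 // => k _; rewrite scale0r.
have [v c_neq0] : exists v, qform S v != 0.
  apply: contrapT => /forallNP all0; move/eqP: S_neq0; apply.
  by apply: qform_eq0 => // v; apply/eqP/negPn/negP/all0.
pose c := qform S v; pose w := S *m v.
pose S' := S - c^-1 *: (w *m w^T).
have wT : w^T = v^T *m S by rewrite trmx_mul symS.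
have S'v : S' *m v = 0.
  rewrite mulmxBl -scalemxAl -mulmxA wT [v^T *m S *m v]mx11_scalar -/(qform S v).
  by rewrite mul_mx_scalar scalerA mulVf // scale1r subrr.
have symS' : S'^T = S'.
  by rewrite linearB /= linearZ /= trmx_mul trmxK symS.
have ltS' : (S' < S)%MS.
  (* Strictness: if S = A S', then S' v = 0 would give S v = 0. *)
  rewrite ltmxE; apply/andP; split.
    rewrite /S' wT scalemxAl mulmxA -[X in (X - _ <= _)%MS]mul1mx -mulmxBl.
    exact: submxMl.
  apply/negP => /submxP[A SA]; move/eqP: c_neq0; apply.
  by rewrite /qform -mulmxA SA -mulmxA S'v !mulmx0 mxE.
have [|d [u S'E]] := IH S' symS'.
  by rewrite -ltnS (leq_trans (rank_ltmx ltS')).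
exists (fun k => oapp d c^-1 (unlift ord0 k)),
       (fun k => oapp u w (unlift ord0 k)).
rewrite big_ord_recl /= unlift_none /=.
under eq_bigr do rewrite liftK /=.
by rewrite -S'E addrC subrK.
Qed.

End QuadraticForms.

(** * The real part of x x^* *)

Section RealGram.
Variables (R : realType) (n : nat).
Implicit Types (x y : 'cV[R[i]]_n) (a b v : 'cV[R]_n).

Definition re_gram x : 'M[R]_n :=
  \matrix_(i, j) complex.Re (x i 0 * Num.conj (x j 0)).

Definition cplx_vec a b : 'cV[R[i]]_n := \col_i (a i 0 +i* b i 0).

Lemma conjE (p q : R) : Num.conj (p +i* q) = p -i* q.
Proof. by []. Qed.

Lemma re_gramE x i j :
  re_gram x i j = complex.Re (x i 0) * complex.Re (x j 0)
                + complex.Im (x i 0) * complex.Im (x j 0).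
Proof.
rewrite mxE; case: (x i 0) (x j 0) => [p q] [p' q'].
by rewrite conjE /= mulrN opprK.
Qed.

Lemma re_gram_cplx a b : re_gram (cplx_vec a b) = a *m a^T + b *m b^T.
Proof. by apply/matrixP => i j; rewrite re_gramE !mxE !big_ord1 !mxE. Qed.

Lemma cplx_vecE x :
  x = cplx_vec (map_mx (@complex.Re R) x) (map_mx (@complex.Im R) x).
Proof.
by apply/matrixP => i j; rewrite ord1 !mxE; case: (x i 0).
Qed.

Lemma complex_sum (I : finType) (f g : I -> R) :
  \sum_j (f j +i* g j) = (\sum_j f j) +i* (\sum_j g j).
Proof. by elim/big_rec3: _ => // j p q _ _ ->. Qed.

Lemma inner_real a b (phi : 'cV[R[i]]_n) :
  (forall j, complex.Im (phi j 0) = 0) ->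
  let v := map_mx (@complex.Re R) phi in
  inner (cplx_vec a b) phi = (a^T *m v) 0 0 +i* (b^T *m v) 0 0.
Proof.
move=> real_phi v; rewrite !mxE -complex_sum; apply: eq_bigr => j _.
rewrite !mxE; have := real_phi j; case: (phi j 0) => p q /= ->.
by rewrite conjE /=; congr (_ +i* _); ring.
Qed.

Lemma sqr_norm_inner x (phi : 'cV[R[i]]_n) :
  (forall j, complex.Im (phi j 0) = 0) ->
  `|inner x phi| ^+ 2 = (qform (re_gram x) (map_mx (@complex.Re R) phi))%:C.
Proof.
move=> real_phi; rewrite [x]cplx_vecE inner_real // re_gram_cplx qformD.
by rewrite !qform_square -add_Re2_Im2.
Qed.

(** The form in which measurements are compared: squaring loses nothing, as
    both sides are nonnegative. *)
Lemma eq_norm_inner x y (phi : 'cV[R[i]]_n) :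
  (forall j, complex.Im (phi j 0) = 0) ->
  let v := map_mx (@complex.Re R) phi in
  `|inner x phi| = `|inner y phi| <->
  qform (re_gram x) v = qform (re_gram y) v.
Proof.
move=> real_phi /=; split => [e|e].
  by apply/complexI; rewrite -!sqr_norm_inner // e.
by apply/eqP; rewrite -(@eqrXn2 _ 2) // !sqr_norm_inner // e.
Qed.

(** arccos determines the angle up to sign; the sign of the imaginary part
    decides which. *)
Lemma expi_surj (z : R[i]) : `|z| = 1 -> exists theta : R, z = expi theta.
Proof.
case: z => p q z1.
have /complexI /= pq1 : (p ^+ 2 + q ^+ 2)%:C = 1%:C.
  by rewrite (add_Re2_Im2 (p +i* q)) z1 expr1n.
have p1 : -1 <= p <= 1 by apply/andP; split; nra.
have s : Num.sqrt (1 - p ^+ 2) = `|q| by rewrite -pq1 addrAC subrr add0r sqrtr_sqr.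
have cp : cos (acos p) = p by apply: acosK; rewrite in_itv.
have [q0|q0] := leP 0 q.
  exists (acos p); rewrite /expi cp sin_acos // s ger0_norm //.
exists (- acos p); rewrite /expi cosN sinN cp sin_acos // s ltr0_norm //.
by rewrite opprK.
Qed.

Lemma norm_expi (theta : R) : `|expi theta| = 1.
Proof. by rewrite normc_def /= cos2Dsin2 sqrtr1. Qed.

Lemma re_gram_expi (theta : R) x : re_gram (expi theta *: x) = re_gram x.
Proof.
apply/matrixP => i j; rewrite !mxE rmorphM mulrACA -normCK norm_expi expr1n.
by rewrite mul1r.
Qed.

Lemma re_gram_conj x : re_gram (conj_vec x) = re_gram x.
Proof.
apply/matrixP => i j; rewrite !re_gramE !mxE.
by case: (x i 0) (x j 0) => [p q] [p' q']; rewrite !conjE /= mulrNN.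
Qed.

Lemma re_gram_eq0 x : re_gram x = 0 -> x = 0.
Proof.
move=> x0; apply/matrixP => i j; rewrite ord1 mxE.
have := congr1 (fun A : 'M[R]_n => A i i) x0; rewrite re_gramE mxE.
case: (x i 0) => p q /= pq0; apply/eqP; rewrite eq_complex /=.
by apply/andP; split; apply/eqP; nra.
Qed.

(** Coordinates agree up to individual signs, and the products a_i a_l against
    a nonzero coordinate b_l force these signs to be the same. *)
Lemma rank1_inj a b : a *m a^T = b *m b^T -> a = b \/ a = - b.
Proof.
move=> ab.
have abE i j : a i 0 * a j 0 = b i 0 * b j 0.
  by have := congr1 (fun A : 'M[R]_n => A i j) ab; rewrite !mxE !big_ord1 !mxE.
have [b0|] := pselect (b = 0).
  left; apply/matrixP => i j; rewrite ord1; apply/eqP.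
  by rewrite b0 mxE -sqrf_eq0 expr2 abE b0 mxE mul0r.
move/eqP/cV0Pn => [l bl].
have /eqP : a l 0 ^+ 2 = b l 0 ^+ 2 by rewrite !expr2 abE.
rewrite eqf_sqr => /orP[]/eqP al; [left|right]; apply/matrixP => i j.
  by rewrite ord1; apply: (mulIf bl); rewrite -{1}al abE.
by rewrite ord1 mxE; apply: (mulIf bl); rewrite mulNr -abE al mulrN opprK.
Qed.

(** The real parts of x_j conj(x_k) and y_j conj(y_k) agree, and the products of
    imaginary parts are also determined by the real Gram matrix, because
    Im(x_i conj(x_k)) Im(x_j conj(x_k)) equals
    Re(x_i conj(x_j)) |x_k|^2 - Re(x_i conj(x_k)) Re(x_j conj(x_k)).
    So x_j conj(x_k) is y_j conj(y_k) for all j or its conjugate for all j;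
    dividing by conj(x_k), which has the modulus of y_k, gives the phase. *)
Lemma re_gram_inj x y : re_gram x = re_gram y ->
  exists theta : R, x = expi theta *: y \/ x = expi theta *: conj_vec y.
Proof.
move=> xy.
have xyE i j : complex.Re (x i 0 * Num.conj (x j 0)) =
               complex.Re (y i 0 * Num.conj (y j 0)).
  by have := congr1 (fun A : 'M[R]_n => A i j) xy; rewrite !mxE.
have normE i : `|x i 0| = `|y i 0|.
  apply/eqP; rewrite -(@eqrXn2 _ 2) // -!add_Re2_Im2; apply/eqP; congr (_%:C).
  by have := congr1 (fun A : 'M[R]_n => A i i) xy; rewrite !re_gramE -!expr2.
have [y0|/eqP/cV0Pn[k yk]] := pselect (y = 0).
  exists 0; left; rewrite y0 scaler0; apply: re_gram_eq0; rewrite xy y0.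
  by apply/matrixP => i j; rewrite !mxE mul0r.
have xk : x k 0 != 0 by rewrite -normr_eq0 normE normr_eq0.
have cxk : Num.conj (x k 0) != 0 by rewrite conjC_eq0.
pose p : 'cV[R]_n := \col_j complex.Im (x j 0 * Num.conj (x k 0)).
pose q : 'cV[R]_n := \col_j complex.Im (y j 0 * Num.conj (y k 0)).
have pq : p *m p^T = q *m q^T.
  apply/matrixP => i j; rewrite !mxE !big_ord1 !mxE.
  have e1 := xyE i j; have e2 := xyE i k; have e3 := xyE j k.
  have := normE k; move=> /(congr1 (fun z => z ^+ 2)); rewrite -!add_Re2_Im2.
  move=> /complexI; move: e1 e2 e3.
  case: (x i 0) (x j 0) (x k 0) => [a1 a2] [b1 b2] [c1 c2].
  case: (y i 0) (y j 0) (y k 0) => [a1' a2'] [b1' b2'] [c1' c2'].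
  rewrite !conjE /= => e1 e2 e3 e4.
  have E : (a1 * - c2 + a2 * c1) * (b1 * - c2 + b2 * c1)
    = (a1 * b1 - a2 * - b2) * (c1 ^+ 2 + c2 ^+ 2)
      - (a1 * c1 - a2 * - c2) * (b1 * c1 - b2 * - c2) by ring.
  by rewrite E e1 e2 e3 e4; ring.
have [theta thetaE] : exists theta, y k 0 / Num.conj (x k 0) = expi theta.
  apply: expi_surj; rewrite normrM normfV norm_conjC normE divff //.
  by rewrite normr_eq0.
have [theta' theta'E] : exists theta, Num.conj (y k 0) / Num.conj (x k 0) = expi theta.
  apply: expi_surj; rewrite normrM normfV !norm_conjC normE divff //.
  by rewrite normr_eq0.
case: (rank1_inj pq) => pqE.
  exists theta'; left; apply/matrixP => i j; rewrite ord1 mxE -theta'E.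
  apply: (mulIf cxk); rewrite mulrAC divfK // [RHS]mulrC; apply/eqP.
  rewrite eq_complex xyE eqxx /=; apply/eqP.
  by have := congr1 (fun A : 'cV[R]_n => A i 0) pqE; rewrite !mxE.
exists theta; right; apply/matrixP => i j; rewrite ord1 !mxE -thetaE.
apply: (mulIf cxk); rewrite mulrAC divfK //; apply/eqP.
have -> : y k 0 * Num.conj (y i 0) = Num.conj (y i 0 * Num.conj (y k 0)).
  by rewrite rmorphM /= conjCK mulrC.
rewrite eq_complex xyE.
have := congr1 (fun A : 'cV[R]_n => A i 0) pqE; rewrite !mxE => ->.
by case: (y i 0 * _) => z1 z2; rewrite conjE /= !eqxx.
Qed.

End RealGram.

(** * Real forms vanishing on a frame *)

Section Frames.
Variables (R : realType) (M N : nat) (Phi : 'I_N -> 'cV[R[i]]_M).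
Hypotheses (frame_Phi : is_frame Phi) (real_Phi : real_valued Phi).

(** The real vector u defines a linear form on the complex space; it vanishes
    on a spanning family, hence on the standard basis. *)
Lemma frame_separates (u : 'cV[R]_M) :
  (forall k, (u^T *m re_family Phi k) 0 0 = 0) -> u = 0.
Proof.
move=> u_perp; pose uC := (map_mx (real_complex R) u)^T.
pose f : 'Hom('cV[R[i]]_M, 'cV[R[i]]_1) := linfun (mulmx uC).
have fE x : f x = uC *m x by rewrite lfunE.
have : (fullv <= lker f)%VS.
  rewrite -frame_Phi; apply/span_subvP => _ /mapP[k _ ->].
  rewrite memv_ker fE; apply/eqP.
  have -> : Phi k = map_mx (real_complex R) (re_family Phi k).
    apply/matrixP => i j; rewrite ord1 !mxE; have := real_Phi k i.
    by case: (Phi k i 0) => p q /= ->.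
  by rewrite /uC map_trmx -map_mxM [_ *m _]mx11_scalar u_perp raddf0 map_mx0.
move=> /subvP ker_f; apply/matrixP => i j; rewrite ord1 mxE.
have := ker_f (delta_mx i 0) (memvf _); rewrite memv_ker fE -colE => /eqP f0.
by have := congr1 (fun A : 'M[R[i]]_1 => A 0 0) f0; rewrite !mxE => /complexI.
Qed.

(** With nonnegative coefficients, a vanishing sum of squares vanishes term by
    term, so each u_k with d_k <> 0 is orthogonal to the whole frame. *)
Lemma frame_isotropic_neg (I : finType) (d : I -> R) (u : I -> 'cV[R]_M) :
  let S := \sum_k d k *: (u k *m (u k)^T) in
  S != 0 -> (forall m, qform S (re_family Phi m) = 0) ->
  exists k, d k < 0.
Proof.
move=> S S_neq0 S_iso; apply: contrapT => /forallNP d_ge0.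
move/eqP: S_neq0; apply; apply: big1 => k _.
have {}d_ge0 j : 0 <= d j by rewrite leNgt; apply/negP/d_ge0.
have [->|dk] := eqVneq (d k) 0; first by rewrite scale0r.
suff -> : u k = 0 by rewrite mul0mx scaler0.
apply: frame_separates => m; apply/eqP; rewrite -sqrf_eq0.
have := S_iso m; rewrite /S qform_sum => /eqP.
rewrite psumr_eq0 => [|j _]; last by rewrite qformZ qform_square mulr_ge0 ?sqr_ge0.
move/allP/(_ k (mem_index_enum _)) => /=.
by rewrite qformZ qform_square mulf_eq0 (negPf dk).
Qed.

End Frames.

(** * Dimension three *)

Section DimensionThree.
Variable R : realType.

(** One of the three squares has weight zero; the other two supply the real and
    imaginary parts of x, after absorbing the weights as square roots. *)
Lemma re_gram_two_squares n (p : 'I_3 -> R) (u : 'I_3 -> 'cV[R]_n) (i : 'I_3) :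
  (forall k, 0 <= p k) -> p i = 0 ->
  exists x : 'cV[R[i]]_n, re_gram x = \sum_k p k *: (u k *m (u k)^T).
Proof.
move=> p_ge0 pi0.
have sqr k : p k *: (u k *m (u k)^T) =
    (Num.sqrt (p k) *: u k) *m (Num.sqrt (p k) *: u k)^T.
  by rewrite linearZ /= -scalemxAl -scalemxAr scalerA -expr2 sqr_sqrtr.
exists (cplx_vec (Num.sqrt (p (lift i 0)) *: u (lift i 0))
                 (Num.sqrt (p (lift i 1)) *: u (lift i 1))).
rewrite re_gram_cplx -!sqr (bigD1_ord i) //= pi0 scale0r add0r.
by rewrite big_ord_recl big_ord1; congr (_ + p (lift i _) *: (u (lift i _) *m (u (lift i _))^T));
  apply: val_inj.
Qed.

(** The positive part of d vanishes at i and its negative part vanishes at j, so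
    each part fits in a single complex vector. *)
Lemma indefinite_re_gramB n (d : 'I_3 -> R) (u : 'I_3 -> 'cV[R]_n) i j :
  d i < 0 -> 0 < d j ->
  exists x y : 'cV[R[i]]_n,
    re_gram x - re_gram y = \sum_k d k *: (u k *m (u k)^T).
Proof.
move=> di dj.
have [||x xE] := @re_gram_two_squares n (fun k => Num.max (d k) 0) u i.
- by move=> k; rewrite le_max lexx orbT.
- by apply/max_idPr/ltW.
have [||y yE] := @re_gram_two_squares n (fun k => Num.max (- d k) 0) u j.
- by move=> k; rewrite le_max lexx orbT.
- by apply/max_idPr; rewrite oppr_le0 ltW.
exists x, y; rewrite xE yE -sumrB; apply: eq_bigr => k _.
rewrite -scalerBl; congr (_ *: _); rewrite -[in - Num.max _ _]oppr0 -oppr_min opprK.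
by rewrite addr_max_min addr0.
Qed.

(** In the ordering of [omega] the squares have indices 0, 1, 2 and the products
    (0,1), (0,2), (1,2) have indices 3, 4, 5, which are i + j + 2. The factor 2
    sits in [omega], so off-diagonal entries are taken without rescaling. *)
Definition sym_of_vec (v : 'cV[R]_6) : 'M[R]_3 :=
  \matrix_(i, j) v (inord (if i == j then i : nat else (i + j).+2)) 0.

Lemma sym_of_vec_sym v : (sym_of_vec v)^T = sym_of_vec v.
Proof.
by apply/matrixP => i j; rewrite !mxE eq_sym addnC; case: eqP => // ->.
Qed.

Lemma sym_of_vec_inj v : sym_of_vec v = 0 -> v = 0.
Proof.
move=> v0; have vE i j := congr1 (fun A : 'M[R]_3 => A i j) v0.
apply/matrixP => k l; rewrite ord1 mxE -[k]inord_val.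
case: k => [[|[|[|[|[|[|//]]]]]] k6] /=.
- by have := vE 0 0; rewrite !mxE.
- by have := vE 1 1; rewrite !mxE.
- by have := vE 2 2; rewrite !mxE.
- by have := vE 0 1; rewrite !mxE.
- by have := vE 0 2; rewrite !mxE.
- by have := vE 1 2; rewrite !mxE.
Qed.

Lemma omega3E (phi : 'cV[R]_3) (v : 'cV[R]_6) :
  ((omega phi)^T *m v) 0 0 = qform (sym_of_vec v) phi.
Proof.
have enum3 : enum 'I_3 = [:: 0; 1; 2].
  by apply: (inj_map val_inj); rewrite val_enum_ord.
rewrite mxE (eq_bigr (fun k : 'I_6 => (omega_seq phi)`_k * v (inord k) 0)); last first.
  by move=> k _; rewrite inord_val !mxE.
rewrite -(big_mkord xpredT (fun k => (omega_seq phi)`_k * v (inord k) 0)).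
rewrite /omega_seq enum3 /= unlock /= /qform.
rewrite -mulmxA mxE !big_ord_recl big_ord0 !mxE !big_ord_recl !big_ord0 !mxE /=.
have -> : lift ord0 ord0 = 1 :> 'I_3 by apply: val_inj.
have -> : lift ord0 (lift ord0 ord0) = 2 :> 'I_3 by apply: val_inj.
rewrite /bump /=; ring.
Qed.

Lemma ker_Omega3P N (Phi : 'I_N -> 'cV[R[i]]_3) (v : 'cV[R]_6) :
  ker_Omega Phi v <->
  forall k, qform (sym_of_vec v) (re_family Phi k) = 0.
Proof.
have rowE k : (Omega Phi *m v) k 0 = qform (sym_of_vec v) (re_family Phi k).
  by rewrite -omega3E !mxE; apply: eq_bigr => j _; rewrite !mxE.
split=> [ker_v k|iso_v]; first by rewrite -rowE ker_v mxE.
by apply/matrixP => k j; rewrite ord1 [RHS]mxE; apply: etrans (rowE k) _.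
Qed.

Lemma sym_of_vec_onto (S : 'M[R]_3) : S^T = S -> exists v, sym_of_vec v = S.
Proof.
move=> symS.
have S_swap i j : S i j = S j i by rewrite -{1}symS mxE.
pose row_of := [:: 0; 1; 2; 0; 0; 1] : seq 'I_3.
pose col_of := [:: 0; 1; 2; 1; 2; 2] : seq 'I_3.
exists (\col_k S (nth 0 row_of k) (nth 0 col_of k)).
apply/matrixP => i j; rewrite !mxE.
case: i j => [[|[|[|//]]] i3] [[|[|[|//]]] j3]; rewrite inordK //=;
  first [by congr (S _ _); apply: val_inj | by rewrite S_swap; congr (S _ _); apply: val_inj].
Qed.

End DimensionThree.

Theorem theorem4p5 (R : realType) (N : nat) (Phi : 'I_N -> 'cV[R[i]]_3) :
  is_frame Phi -> real_valued Phi ->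
  (conj_phase_retrievable Phi <-> ker_Omega Phi = [set 0]).
Proof.
move=> frame_Phi real_Phi; split=> [cpr_Phi|ker0 x y eq_xy].
  apply/seteqP; split=> [v /ker_Omega3P v_iso|_ ->]; last exact: mulmx0.
  have [//|v_neq0] := pselect (v = 0).
  have S_neq0 : sym_of_vec v != 0.
    by apply/eqP => /sym_of_vec_inj.
  have [d [u SE]] := sum_of_signed_squares (sym_of_vec_sym v) (rank_leq_row _).
  rewrite SE in S_neq0 v_iso.
  have [i di] := frame_isotropic_neg frame_Phi real_Phi S_neq0 v_iso.
  (* Applied to S and to - S, the frame property gives coefficients of both signs. *)
  have SN : \sum_k - d k *: (u k *m (u k)^T) = - \sum_k d k *: (u k *m (u k)^T).
    by rewrite -sumrN; apply: eq_bigr => k _; rewrite scaleNr.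
  have [||j] := @frame_isotropic_neg _ _ _ _ frame_Phi real_Phi _ (fun k => - d k) u.
  - by rewrite SN oppr_eq0.
  - by move=> m; rewrite SN -scaleN1r qformZ v_iso mulr0.
  rewrite oppr_lt0 => dj.
  have [x [y xyE]] := indefinite_re_gramB u di dj.
  case/negP: S_neq0; rewrite -xyE subr_eq0; apply/eqP.
  have [k|theta] := cpr_Phi x y.
    apply/(eq_norm_inner _ _ (real_Phi k)); apply/eqP.
    by rewrite -subr_eq0 -mulN1r -qformZ -qformD scaleN1r xyE v_iso.
  by case=> ->; rewrite re_gram_expi // re_gram_conj.
apply: re_gram_inj; apply/eqP; rewrite -subr_eq0; apply/eqP.
have sym_gram z : (re_gram z)^T = re_gram z :> 'M[R]_3.
  by apply/matrixP => i j; rewrite mxE !re_gramE !(mulrC (_ (z j 0))).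
have [|v vE] := @sym_of_vec_onto _ (re_gram x - re_gram y).
  by rewrite linearB /= !sym_gram.
have : ker_Omega Phi v.
  apply/ker_Omega3P => k; rewrite vE -scaleN1r qformD qformZ mulN1r.
  by apply/eqP; rewrite subr_eq0; apply/eqP/eq_norm_inner.
rewrite ker0 -vE => ->.
by apply/matrixP => i j; rewrite !mxE.
Qed.
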